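(* Let $\omega_0=m+n\omega$ with $m,n\in\mathbb{Z}$ relatively prime and $n$ odd, and let $\ell(t)=\frac12+t\omega_0$, $t\in\mathbb{R}$. If $\omega_0\in Hex$, then the curve $\gamma(t)=\pi(\ell(t))$, $t\in[0,1]$, is a primitive closed geodesic in $2\Delta$. If $\omega_0\notin Hex$, then the curve $\gamma(t)=\pi(\ell(t))$, $t\in[0,3]$, is a primitive closed geodesic in $2\Delta$.
   Context: Let $\omega=\exp(2\pi i/6)$ and $\Lambda_{1,\omega}=\mathbb{Z}+\mathbb{Z}\omega\subset\mathbb{C}$. Let $\Delta$ be the Euclidean equilateral triangle with vertices $0,1,\omega$, decorated with the symbols $\circ,\bullet,\ast$ respectively. $2\Delta$ is the sphere obtained by gluing $\Delta$ and its reflection $\bar\Delta$ in the real axis along their boundaries via $z\mapsto\bar z$, with its flat metric with conic singularities at the three vertices. Let $\Gamma_{3,3,3}$ be the group of orientation-preserving isometries of $\mathbb{C}$ generated by the rotations of angle $2\pi/3$ about $0,1,\omega$; then $2\Delta=\mathbb{C}/\Gamma_{3,3,3}$, and $\pi:\mathbb{C}\to 2\Delta$ is the natural projection. The associated tessellation of $\mathbb{C}$ is by unit equilateral triangles with vertex set $\Lambda_{1,\omega}$, decorated $\Gamma_{3,3,3}$-invariantly and compatibly with $\Delta$; $Hex$ is the sub-lattice of $\Lambda_{1,\omega}$ of vertices decorated $\circ$, equivalently the lattice of translations in $\Gamma_{3,3,3}$; $Hex=\langle 2-\omega,\,1+\omega\rangle=\{a+b\omega: a\equiv b \bmod 3\}$.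 A closed geodesic in $2\Delta$ is a smooth closed curve not passing through the vertices which is locally geodesic for the flat metric (including at the closing point); it is parametrized by a constant multiple of arc-length. It is primitive if it is not a proper multiple (iterate) of a shorter closed geodesic. *)

(* Defs.v *)
From Stdlib Require Export Reals ZArith Znumtheory.
From Coquelicot Require Export Coquelicot.

Set Implicit Arguments.
Local Open Scope R_scope.

Definition cis (theta : R) : C := (cos theta, sin theta).

Definition omega : C := cis (2 * PI / 6).

Definition Lambda (z : C) : Prop :=
  exists a b : Z, z = (RtoC (IZR a) + RtoC (IZR b) * omega)%C.

Inductive decoration : Set := circ | bullet | ast.

Definition corner (s : decoration) : C :=
  match s with
  | circ => RtoC 0
  | bullet => RtoC 1
  | ast => omega
  end.

Definition rotation (p : C) (theta : R) (z : C) : C :=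
  (p + cis theta * (z - p))%C.

Inductive generated (S : (C -> C) -> Prop) : (C -> C) -> Prop :=
| generated_id : generated S (fun z => z)
| generated_base g : S g -> generated S g
| generated_comp g h :
    generated S g -> generated S h -> generated S (fun z => g (h z))
| generated_inv g h :
    generated S g -> (forall z, h (g z) = z) -> (forall z, g (h z) = z) ->
    generated S h.

Definition Gamma333 : (C -> C) -> Prop :=
  generated (fun g => exists s : decoration,
                        g = rotation (corner s) (2 * PI / 3)).

Definition orbit (z : C) : C -> Prop :=
  fun w => exists g, Gamma333 g /\ w = g z.

(* The double 2Delta of the triangle with vertices 0, 1, omega, realized as
   the orbit space C / Gamma333: Delta together with one of its mirror images
   is a fundamental domain, and Gamma333 glues the two along their boundary. *)
Record double_triangle : Type := DoubleTriangle {
  class :> C -> Prop;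
  class_is_orbit : exists z, class = orbit z
}.

Definition proj (z : C) : double_triangle :=
  DoubleTriangle (ex_intro _ z eq_refl).

Definition is_vertex (x : double_triangle) : Prop :=
  exists s : decoration, x = proj (corner s).

(* The decoration of the vertices of the tessellation is the
   Gamma333-invariant one that extends the decoration of Delta. *)
Definition decorated (z : C) (s : decoration) : Prop :=
  Lambda z /\ proj z = proj (corner s).

Definition Hex (z : C) : Prop := decorated z circ.

(* Gamma333 acts by isometries, so the flat metric of the quotient is the
   distance between orbits. *)
Definition flat_dist (x y : double_triangle) : R :=
  real (Glb_Rbar (fun r => exists z w : C, x z /\ y w /\ r = Cmod (z - w)%C)).

(* A closed curve is given by c : R -> double_triangle and T > 0, of which only
   the restriction of c to [0, T] matters.  Since frac_part takes its values in
   [0, 1), the following is the T-periodic extension of c restricted to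
   [0, T). *)
Definition periodize (c : R -> double_triangle) (T : R) : R -> double_triangle :=
  fun t => c (T * frac_part (t / T)).

(* Away from the vertices, proj is a covering and its local inverses are the
   charts of 2Delta: smoothness is smoothness of local lifts to C. *)
Definition smooth_curve (c : R -> double_triangle) : Prop :=
  forall t : R, exists (eps : R) (f : R -> C),
    0 < eps /\
    forall s : R, Rabs (s - t) < eps ->
      c s = proj (f s) /\
      forall k : nat, ex_derive_n (fun u => fst (f u)) k s /\
                      ex_derive_n (fun u => snd (f u)) k s.

(* Local geodesic, parametrized by v times arc length. *)
Definition locally_geodesic (c : R -> double_triangle) (v : R) : Prop :=
  forall t : R, exists eps : R,
    0 < eps /\
    forall s s' : R, Rabs (s - t) < eps -> Rabs (s' - t) < eps ->
      flat_dist (c s) (c s') = v * Rabs (s - s').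

(* Imposing smoothness and the geodesic condition on the periodic extension
   includes them at the closing point. *)
Definition closed_geodesic (c : R -> double_triangle) (T : R) : Prop :=
  0 < T /\
  c 0 = c T /\
  (forall t : R, 0 <= t <= T -> ~ is_vertex (c t)) /\
  smooth_curve (periodize c T) /\
  exists v : R, 0 < v /\ locally_geodesic (periodize c T) v.

(* c on [0, T] is d on [0, S] run through k times, up to the affine change of
   parameter [0, T] -> [0, k * S]. *)
Definition iterate_of (k : nat) (d : R -> double_triangle) (S : R)
    (c : R -> double_triangle) (T : R) : Prop :=
  forall t : R, 0 <= t <= T -> c t = periodize d S (INR k * S / T * t).

(* For k >= 2 such a d is necessarily shorter, by the factor k.  A different
   starting point or orientation for d needs no separate clause, since the
   closed geodesics are stable under both changes. *)
Definition primitive_closed_geodesic (c : R -> double_triangle) (T : R) : Prop :=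
  closed_geodesic c T /\
  ~ (exists (k : nat) (d : R -> double_triangle) (S : R),
       (2 <= k)%nat /\ closed_geodesic d S /\ iterate_of k d S c T).

(* Main.v *)
(* The group [Gamma333] consists of the motions [z -> u z + h] with [u] a cube
   root of unity and [h] in [Hex].  A nontrivial one displaces a point off
   [Lambda] by an amount bounded below, so [proj] is an isometry near such a
   point, and the line [ell], which avoids [Lambda] because [n] is odd, projects
   to a local geodesic.  It closes up after time [T] as soon as
   [T omega0] is in [Hex].  If the resulting curve were a [k]-fold iterate, each
   [ell (t + T / k)] would be the image of [ell t] under some motion in the
   group; a nontrivial rotational part can be shared only by values of [t] that are not too
   close, so by pigeonhole some motion is a translation and [(T / k) omega0] is
   in [Hex].  Coprimality of [m] and [n] forces [k] to divide [T], whence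
   [k = 1] when [T = 1], and [k = 3] gives [omega0] in [Hex] when [T = 3]. *)
Require Import Defs.
From Stdlib Require Import Lra Lia FunctionalExtensionality PropExtensionality
  ProofIrrelevance.

Local Open Scope R_scope.

(** * Coordinates in the basis [1], [omega], and the hexagonal lattice *)

(** In these coordinates multiplication by [zeta] has an integer matrix, so questions about the
    lattices become linear integer arithmetic. *)
Definition oblique (x y : R) : C := (RtoC x + RtoC y * omega)%C.

Definition zeta : C := cis (2 * PI / 3).

Lemma omegaE : omega = (1 / 2, sqrt 3 / 2).
Proof.
unfold omega, cis.
replace (2 * PI / 6) with (PI / 3) by field.
now rewrite cos_PI3, sin_PI3.
Qed.

Lemma zetaE : zeta = (- 1 / 2, sqrt 3 / 2).
Proof.
unfold zeta, cis.
replace (2 * PI / 3) with (2 * (PI / 3)) by field.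
now rewrite cos_2PI3, sin_2PI3.
Qed.

Lemma obliqueE x y : oblique x y = (x + y / 2, y * sqrt 3 / 2).
Proof.
unfold oblique; rewrite omegaE.
apply injective_projections; simpl; field.
Qed.

Lemma sqrt3_sqr : sqrt 3 * sqrt 3 = 3.
Proof. apply sqrt_sqrt; lra. Qed.

Lemma oblique_surj z : exists x y, z = oblique x y.
Proof.
assert (H : 0 < sqrt 3) by (apply sqrt_lt_R0; lra).
exists (fst z - snd z / sqrt 3), (2 * snd z / sqrt 3).
rewrite obliqueE; apply injective_projections; simpl; field; lra.
Qed.

Lemma oblique_inj x y x' y' : oblique x y = oblique x' y' -> x = x' /\ y = y'.
Proof.
rewrite !obliqueE; intros E; injection E; intros E2 E1.
assert (H : 0 < sqrt 3) by (apply sqrt_lt_R0; lra).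
assert (y = y') by (apply (Rmult_eq_reg_r (sqrt 3)); lra).
split; lra.
Qed.

Lemma oblique_add x y x' y' :
  (oblique x y + oblique x' y')%C = oblique (x + x') (y + y').
Proof. rewrite !obliqueE; apply injective_projections; simpl; field. Qed.

Lemma oblique_opp x y : (- oblique x y)%C = oblique (- x) (- y).
Proof. rewrite !obliqueE; apply injective_projections; simpl; field. Qed.

Lemma oblique_scal t x y :
  (RtoC t * oblique x y)%C = oblique (t * x) (t * y).
Proof. rewrite !obliqueE; apply injective_projections; simpl; field. Qed.

Lemma RtoC_oblique x : RtoC x = oblique x 0.
Proof. rewrite obliqueE; apply injective_projections; simpl; field. Qed.

Lemma omega_oblique : omega = oblique 0 1.
Proof. rewrite obliqueE, omegaE; apply injective_projections; simpl; field. Qed.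

(** Since [zeta = omega - 1 = omega^2], multiplication by it sends [1] to [omega - 1] and [omega] to
    [-1]. *)
Lemma zeta_oblique x y : (zeta * oblique x y)%C = oblique (- x - y) x.
Proof.
rewrite !obliqueE, zetaE.
apply injective_projections; simpl; [| field].
transitivity (- x / 2 - y / 4 - y * (sqrt 3 * sqrt 3) / 4); [field |].
rewrite sqrt3_sqr; field.
Qed.

Lemma zeta_cube : (zeta * zeta * zeta)%C = RtoC 1.
Proof.
rewrite <- (Cmult_1_r (zeta * zeta * zeta)), !RtoC_oblique.
rewrite <- !Cmult_assoc, !zeta_oblique.
f_equal; ring.
Qed.

Lemma Cmod_zeta : Cmod zeta = 1.
Proof.
rewrite zetaE; unfold Cmod; simpl.
transitivity (sqrt 1); [f_equal | apply sqrt_1].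
transitivity (1 / 4 + sqrt 3 * sqrt 3 / 4); [field | rewrite sqrt3_sqr; field].
Qed.

Lemma Cmod_oblique_sqr x y : Cmod (oblique x y) ^ 2 = x ^ 2 + x * y + y ^ 2.
Proof.
unfold Cmod; rewrite pow2_sqrt.
- rewrite obliqueE; simpl.
  transitivity (x ^ 2 + x * y + y ^ 2 / 4 + y ^ 2 * (sqrt 3 * sqrt 3) / 4);
    [field | rewrite sqrt3_sqr; field].
- apply Rplus_le_le_0_compat; apply pow2_ge_0.
Qed.

Lemma half_Rabs_le_Cmod r z : r ^ 2 <= 4 * Cmod z ^ 2 -> Rabs r / 2 <= Cmod z.
Proof.
intros H; pose proof (Rabs_pos r); pose proof (Cmod_ge_0 z).
rewrite <- pow2_abs in H; nra.
Qed.

(** Here [4 (x^2 + x y + y^2) = (x - y)^2 + 3 (x + y)^2]; the next two bounds complete the square as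
    [(x + 2 y)^2 + 3 x^2] and [(2 x + y)^2 + 3 y^2]. These three linear forms are the ones that
    isolate a single coordinate in the displacement of a point by a rotation. *)
Lemma Cmod_oblique_sub x y : Rabs (x - y) / 2 <= Cmod (oblique x y).
Proof.
apply half_Rabs_le_Cmod; rewrite Cmod_oblique_sqr.
pose proof (pow2_ge_0 (x + y)); nra.
Qed.

Lemma Cmod_oblique_add2r x y : Rabs (x + 2 * y) / 2 <= Cmod (oblique x y).
Proof.
apply half_Rabs_le_Cmod; rewrite Cmod_oblique_sqr.
pose proof (pow2_ge_0 x); nra.
Qed.

Lemma Cmod_oblique_add2l x y : Rabs (2 * x + y) / 2 <= Cmod (oblique x y).
Proof.
apply half_Rabs_le_Cmod; rewrite Cmod_oblique_sqr.
pose proof (pow2_ge_0 y); nra.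
Qed.

(* The point [a + b omega] of the hexagonal lattice, [a = b + 3 k]. *)
Definition hex_pt (k b : Z) : C := oblique (IZR b + 3 * IZR k) (IZR b).

Lemma hex_pt_add k b k' b' :
  (hex_pt k b + hex_pt k' b')%C = hex_pt (k + k') (b + b').
Proof.
unfold hex_pt; rewrite oblique_add, !plus_IZR; f_equal; ring.
Qed.

Lemma hex_pt_opp k b : (- hex_pt k b)%C = hex_pt (- k) (- b).
Proof. unfold hex_pt; rewrite oblique_opp, !opp_IZR; f_equal; ring. Qed.

Lemma hex_pt0 : hex_pt 0 0 = RtoC 0.
Proof. unfold hex_pt; rewrite RtoC_oblique; f_equal; ring. Qed.

Lemma zeta_hex_pt k b : (zeta * hex_pt k b)%C = hex_pt (- b - 2 * k) (b + 3 * k).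
Proof.
unfold hex_pt; rewrite zeta_oblique.
rewrite !minus_IZR, !plus_IZR, !mult_IZR, !opp_IZR; f_equal; ring.
Qed.

(** * Explicit form of the motions in the group *)

Definition hex_unit (u : C) : Prop :=
  u = RtoC 1 \/ u = zeta \/ u = (zeta * zeta)%C.

Lemma hex_unit_mul u v : hex_unit u -> hex_unit v -> hex_unit (u * v)%C.
Proof.
pose proof zeta_cube as Z3.
assert (Z4 : (zeta * zeta * (zeta * zeta) = zeta)%C)
  by (transitivity (zeta * zeta * zeta * zeta)%C; [ring | rewrite Z3; ring]).
intros [-> | [-> | ->]] [-> | [-> | ->]];
  rewrite ?Cmult_1_l, ?Cmult_1_r, ?Z4, ?Cmult_assoc, ?Z3; unfold hex_unit; auto.
Qed.

Lemma hex_unit_inv u : hex_unit u -> exists v, hex_unit v /\ (v * u)%C = RtoC 1.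
Proof.
intros [-> | [-> | ->]].
- exists (RtoC 1); split; [now left | ring].
- exists (zeta * zeta)%C; split; [right; now right | apply zeta_cube].
- exists zeta; split; [right; now left | rewrite Cmult_assoc; apply zeta_cube].
Qed.

Lemma hex_unit_hex_pt u k b :
  hex_unit u -> exists k' b', (u * hex_pt k b)%C = hex_pt k' b'.
Proof.
intros [-> | [-> | ->]].
- exists k, b; ring.
- rewrite zeta_hex_pt; eauto.
- rewrite <- Cmult_assoc, !zeta_hex_pt; eauto.
Qed.

Lemma Cmod_hex_unit u : hex_unit u -> Cmod u = 1.
Proof.
intros [-> | [-> | ->]].
- apply Cmod_1.
- apply Cmod_zeta.
- rewrite Cmod_mult, Cmod_zeta; ring.
Qed.

Definition hex_motion (g : C -> C) : Prop :=
  exists u k b, hex_unit u /\ forall z, g z = (u * z + hex_pt k b)%C.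

Lemma hex_motion_inverse g :
  hex_motion g -> exists h, hex_motion h /\ forall z, h (g z) = z.
Proof.
intros (u & k & b & Hu & Hg).
destruct (hex_unit_inv u Hu) as (v & Hv & Hvu).
destruct (hex_unit_hex_pt v k b Hv) as (k' & b' & E).
exists (fun z => (v * z + hex_pt (- k') (- b'))%C); split.
- now exists v, (- k')%Z, (- b')%Z.
- intros z; rewrite Hg, <- hex_pt_opp, <- E.
  transitivity (v * u * z)%C; [ring | rewrite Hvu; ring].
Qed.

(** The translation part of the rotation about [p] is [(1 - zeta) p], which is [0], [2 - omega],
    [1 + omega] at the three corners. *)
Lemma corner_rotation s :
  exists k b, forall z,
    rotation (corner s) (2 * PI / 3) z = (zeta * z + hex_pt k b)%C.
Proof.
assert (H : exists k b, hex_pt k b = (corner s - zeta * corner s)%C).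
{ destruct s; simpl corner.
  - exists 0%Z, 0%Z; rewrite hex_pt0; ring.
  - exists 1%Z, (-1)%Z; unfold Cminus, hex_pt.
    rewrite RtoC_oblique, zeta_oblique, oblique_opp, oblique_add; f_equal; ring.
  - exists 0%Z, 1%Z; unfold Cminus, hex_pt.
    rewrite omega_oblique, zeta_oblique, oblique_opp, oblique_add; f_equal; ring. }
destruct H as (k & b & E); exists k, b; intros z.
unfold rotation; fold zeta; rewrite E; ring.
Qed.

Lemma Gamma333_motion g : Gamma333 g -> hex_motion g.
Proof.
intros H; induction H as [| g [s ->] | g h _ IHg _ IHh | g h _ IHg Hl Hr].
- exists (RtoC 1), 0%Z, 0%Z; split; [now left | intros z; rewrite hex_pt0; ring].
- destruct (corner_rotation s) as (k & b & E).
  exists zeta, k, b; split; [right; now left | exact E].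
- destruct IHg as (u & k & b & Hu & Eg), IHh as (v & k' & b' & Hv & Eh).
  destruct (hex_unit_hex_pt u k' b' Hu) as (k2 & b2 & E).
  exists (u * v)%C, (k2 + k)%Z, (b2 + b)%Z; split; [now apply hex_unit_mul |].
  intros z; rewrite Eg, Eh, <- hex_pt_add, <- E; ring.
(* As [h] is a right inverse of [g], it coincides with the left inverse [h'], which has the required
   form. *)
- destruct (hex_motion_inverse g IHg) as (h' & (u & k & b & Hu & E) & Hh').
  exists u, k, b; split; [exact Hu |].
  intros z; rewrite <- E, <- (Hh' (h z)), Hr; reflexivity.
Qed.

(** [generated_inv] accepts only a two-sided inverse that is already at hand; the explicit form of
    [g] provides one. *)
Lemma Gamma333_inverse g :
  Gamma333 g -> exists h, Gamma333 h /\ (forall z, h (g z) = z).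
Proof.
intros Hg.
destruct (Gamma333_motion g Hg) as (u & k & b & Hu & Eg).
destruct (hex_unit_inv u Hu) as (v & _ & Hvu).
set (h := fun z => (v * (z - hex_pt k b))%C).
assert (Hl : forall z, h (g z) = z).
{ intros z; unfold h; rewrite Eg.
  transitivity (v * u * z)%C; [ring | rewrite Hvu; ring]. }
assert (Hr : forall z, g (h z) = z).
{ intros z; unfold h; rewrite Eg.
  transitivity (v * u * (z - hex_pt k b) + hex_pt k b)%C;
    [ring | rewrite Hvu; ring]. }
exists h; split; [now apply (generated_inv (g := g)) | exact Hl].
Qed.

Lemma Gamma333_dist g z w : Gamma333 g -> Cmod (g z - g w) = Cmod (z - w).
Proof.
intros Hg; destruct (Gamma333_motion g Hg) as (u & k & b & Hu & Eg).
rewrite !Eg.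
replace (u * z + hex_pt k b - (u * w + hex_pt k b))%C with (u * (z - w))%C by ring.
rewrite Cmod_mult, Cmod_hex_unit by exact Hu; ring.
Qed.

(** * Translations in the group *)

Definition translation (c : C) (z : C) : C := (z + c)%C.

Lemma translation_add c d :
  Gamma333 (translation c) -> Gamma333 (translation d) ->
  Gamma333 (translation (c + d)).
Proof.
intros Hc Hd.
replace (translation (c + d)) with (fun z => translation c (translation d z)).
- now apply generated_comp.
- apply functional_extensionality; intros z; unfold translation; ring.
Qed.

Lemma translation_mul (k : Z) c :
  Gamma333 (translation c) -> Gamma333 (translation (RtoC (IZR k) * c)).
Proof.
intros Hc.
assert (Hn : forall n : nat, Gamma333 (translation (RtoC (IZR (Z.of_nat n)) * c))).
{ induction n as [| n IH].
  - replace (translation (RtoC (IZR (Z.of_nat 0)) * c)) with (fun z : C => z).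
    + apply generated_id.
    + apply functional_extensionality; intros z; unfold translation; simpl; ring.
  - rewrite Nat2Z.inj_succ, succ_IZR, RtoC_plus.
    replace ((RtoC (IZR (Z.of_nat n)) + RtoC 1) * c)%C
      with (RtoC (IZR (Z.of_nat n)) * c + c)%C by ring.
    now apply translation_add. }
destruct (Z_le_gt_dec 0 k) as [Hk | Hk].
- now rewrite <- (Z2Nat.id k Hk).
- apply (generated_inv _ (Hn (Z.to_nat (- k))));
    intros z; unfold translation;
    rewrite Z2Nat.id by lia; rewrite opp_IZR, RtoC_opp; ring.
Qed.

Lemma Gamma333_rotation_corner s :
  Gamma333 (rotation (corner s) (2 * PI / 3)).
Proof. apply generated_base; now exists s. Qed.

(* Two rotations by [2 PI / 3] about [0] and one about a corner have total
   angle [2 PI]. *)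
Lemma translation_corner s :
  Gamma333 (translation (corner s - zeta * corner s)).
Proof.
pose proof (Gamma333_rotation_corner circ) as H0.
replace (translation (corner s - zeta * corner s)) with
  (fun z => rotation (corner s) (2 * PI / 3)
    (rotation (corner circ) (2 * PI / 3) (rotation (corner circ) (2 * PI / 3) z))).
- apply generated_comp with (2 := generated_comp H0 H0).
  apply Gamma333_rotation_corner.
- apply functional_extensionality; intros z.
  unfold translation, rotation; simpl corner; fold zeta.
  transitivity (zeta * zeta * zeta * z + (corner s - zeta * corner s))%C;
    [ring | rewrite zeta_cube; ring].
Qed.

(** The corners [1] and [omega] yield translations by [2 - omega] and [1 + omega], which generate
    the lattice: [k (2 - omega) + (b + k) (1 + omega) = (b + 3 k) + b omega]. *)
Lemma translation_hex_pt k b : Gamma333 (translation (hex_pt k b)).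
Proof.
replace (hex_pt k b) with
  (RtoC (IZR k) * (corner bullet - zeta * corner bullet) +
   RtoC (IZR (b + k)) * (corner ast - zeta * corner ast))%C.
- apply translation_add; apply translation_mul, translation_corner.
- simpl corner; unfold Cminus, hex_pt.
  rewrite (RtoC_oblique 1), omega_oblique, !zeta_oblique, !oblique_opp,
    !oblique_add, !oblique_scal, oblique_add, plus_IZR.
  f_equal; ring.
Qed.

(** * Points of the quotient, its vertices, and [Hex] *)

Lemma orbit_refl z : orbit z z.
Proof. exists (fun w => w); split; [apply generated_id | reflexivity]. Qed.

Lemma proj_eq z w : proj z = proj w <-> exists g, Gamma333 g /\ w = g z.
Proof.
split.
- intros E; change (class (proj z) w); rewrite E; apply orbit_refl.
- intros (g & Hg & ->).
  assert (E : orbit z = orbit (g z)).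
  { apply functional_extensionality; intros x.
    destruct (Gamma333_inverse g Hg) as (h & Hh & Hhg).
    apply propositional_extensionality; split; intros (f & Hf & ->).
    - exists (fun y => f (h y)); split; [now apply generated_comp | now rewrite Hhg].
    - exists (fun y => f (g y)); split; [now apply generated_comp | reflexivity]. }
  unfold proj.
  (* The proof field has a type that mentions the orbit, so it is generalized before the orbit is
     rewritten; afterwards the two records differ only in that proof. *)
  generalize (ex_intro (fun z0 => orbit z = orbit z0) z eq_refl).
  rewrite E; intros e; f_equal; apply proof_irrelevance.
Qed.

Lemma proj_translation z k b : proj (z + hex_pt k b) = proj z.
Proof.
symmetry; apply proj_eq; exists (translation (hex_pt k b)).
split; [apply translation_hex_pt | reflexivity].
Qed.

Lemma Lambda_oblique x y :
  Lambda (oblique x y) -> exists a b, x = IZR a /\ y = IZR b.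
Proof.
intros (a & b & E); exists a, b; now apply oblique_inj.
Qed.

Lemma hex_unit_Lambda u k b z :
  hex_unit u -> Lambda z -> Lambda (u * z + hex_pt k b)%C.
Proof.
intros Hu (p & q & ->); fold (oblique (IZR p) (IZR q)); unfold hex_pt.
destruct Hu as [-> | [-> | ->]];
  [rewrite Cmult_1_l | rewrite zeta_oblique
  | rewrite <- Cmult_assoc, !zeta_oblique];
  rewrite oblique_add.
- exists (p + (b + 3 * k))%Z, (q + b)%Z.
  now rewrite !plus_IZR, mult_IZR.
- exists (- p - q + (b + 3 * k))%Z, (p + b)%Z.
  now rewrite !plus_IZR, mult_IZR, minus_IZR, opp_IZR.
- exists (- (- p - q) - p + (b + 3 * k))%Z, (- p - q + b)%Z.
  now rewrite !plus_IZR, mult_IZR, !minus_IZR, !opp_IZR, minus_IZR, opp_IZR.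
Qed.

Lemma Lambda_corner s : Lambda (corner s).
Proof.
destruct s; simpl; [exists 0%Z, 0%Z | exists 1%Z, 0%Z | exists 0%Z, 1%Z]; ring.
Qed.

(** The corners lie in [Lambda], which the motions preserve. *)
Lemma vertex_Lambda z : is_vertex (proj z) -> Lambda z.
Proof.
intros [s E]; symmetry in E; apply proj_eq in E; destruct E as (g & Hg & ->).
destruct (Gamma333_motion g Hg) as (u & k & b & Hu & ->).
apply hex_unit_Lambda; [exact Hu | apply Lambda_corner].
Qed.

(** A motion sends [0] to its translation part, and conversely every lattice translation is in the
    group. *)
Lemma Hex_hex_pt z : Hex z <-> exists k b, z = hex_pt k b.
Proof.
split.
- intros [_ E]; symmetry in E; apply proj_eq in E; destruct E as (g & Hg & ->).
  destruct (Gamma333_motion g Hg) as (u & k & b & Hu & ->).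
  exists k, b; simpl corner; ring.
- intros (k & b & ->); split.
  + exists (b + 3 * k)%Z, b; now rewrite plus_IZR, mult_IZR.
  + simpl corner; rewrite <- (proj_translation 0 k b); f_equal; ring.
Qed.

(** * Displacement bounds and the local isometry *)

(** A non-integer lies strictly between [up x - 1] and [up x], and no integer is closer to it than
    the nearer of these two. *)
Lemma integer_or_apart x :
  (exists a : Z, x = IZR a) \/
  (exists d, 0 < d /\ forall a : Z, d <= Rabs (x - IZR a)).
Proof.
destruct (archimed x) as [H1 H2].
destruct (Req_dec (IZR (up x) - x) 1) as [E | NE].
- left; exists (up x - 1)%Z; rewrite minus_IZR; lra.
- right; exists (Rmin (IZR (up x) - x) (x - (IZR (up x) - 1))); split.
  + apply Rmin_glb_lt; lra.
  + intros a; destruct (Z_lt_le_dec a (up x)) as [Ha | Ha].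
    * eapply Rle_trans; [apply Rmin_r |].
      eapply Rle_trans; [| apply Rle_abs].
      assert (IZR a <= IZR (up x - 1)) by (apply IZR_le; lia).
      rewrite minus_IZR in H; lra.
    * eapply Rle_trans; [apply Rmin_l |].
      rewrite Rabs_minus_sym; eapply Rle_trans; [| apply Rle_abs].
      apply IZR_le in Ha; lra.
Qed.

(** The form [x - y] takes the value [3 k], and [x + 2 y] takes the value [3 b] when [k = 0]; half
    of a nonzero multiple of 3 exceeds 1 in absolute value. *)
Lemma hex_pt_norm k b : hex_pt k b = RtoC 0 \/ 1 <= Cmod (hex_pt k b).
Proof.
assert (Habs : forall a : Z, a <> 0%Z -> 1 <= Rabs (IZR a)).
{ intros a Ha; rewrite <- abs_IZR; apply IZR_le; lia. }
destruct (Z.eq_dec k 0) as [-> | Hk].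
- destruct (Z.eq_dec b 0) as [-> | Hb].
  + left; apply hex_pt0.
  + right; unfold hex_pt.
    eapply Rle_trans; [| apply Cmod_oblique_add2r].
    replace (IZR b + 3 * 0 + 2 * IZR b) with (3 * IZR b) by ring.
    rewrite Rabs_mult, (Rabs_pos_eq 3) by lra.
    specialize (Habs b Hb); lra.
- right; unfold hex_pt.
  eapply Rle_trans; [| apply Cmod_oblique_sub].
  replace (IZR b + 3 * IZR k - IZR b) with (3 * IZR k) by ring.
  rewrite Rabs_mult, (Rabs_pos_eq 3) by lra.
  specialize (Habs k Hk); lra.
Qed.

(* A rotation in the group displaces [x + y omega] by [a + b omega], where
   [3 x] and [3 y] are, up to sign and modulo 3, integral combinations of
   [a] and [b]. *)
Lemma rotation_displacement u k b x y :
  u = zeta \/ u = (zeta * zeta)%C ->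
  let D := Cmod (u * oblique x y + hex_pt k b - oblique x y)%C in
  (exists a : Z, Rabs (x - IZR a) <= D) /\ (exists a : Z, Rabs (y - IZR a) <= D).
Proof.
assert (H3 : forall r s D, r = 3 * s \/ r = - (3 * s) ->
  Rabs r / 2 <= D -> Rabs s <= D).
{ intros r s D Hr HD.
  assert (E : Rabs r = 3 * Rabs s).
  { destruct Hr as [-> | ->]; rewrite ?Rabs_Ropp, Rabs_mult, (Rabs_pos_eq 3); lra. }
  pose proof (Rabs_pos s); lra. }
intros [-> | ->] D; unfold D, Cminus, hex_pt;
  [| rewrite <- Cmult_assoc];
  rewrite !zeta_oblique, oblique_opp, !oblique_add; split.
- exists k; eapply H3; [| apply Cmod_oblique_sub]; right; ring.
- exists (b + k)%Z; eapply H3; [| apply Cmod_oblique_add2r].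
  right; rewrite plus_IZR; ring.
- exists (b + 2 * k)%Z; eapply H3; [| apply Cmod_oblique_add2l].
  right; rewrite plus_IZR, mult_IZR; ring.
- exists (- k)%Z; eapply H3; [| apply Cmod_oblique_sub].
  left; rewrite opp_IZR; ring.
Qed.

(** Off [Lambda] one coordinate keeps a distance [d] from all integers, so rotations move [p] by at
    least [d]; nontrivial translations move it by at least 1. *)
Lemma Gamma333_displacement p :
  ~ Lambda p -> exists d, 0 < d /\
    forall g, Gamma333 g -> (forall z, g z = z) \/ d <= Cmod (g p - p).
Proof.
intros Hp; destruct (oblique_surj p) as (x & y & ->).
assert (H : exists d, 0 < d /\
  ((forall a : Z, d <= Rabs (x - IZR a)) \/ (forall a : Z, d <= Rabs (y - IZR a)))).
{ destruct (integer_or_apart x) as [[a Ea] | (d & Hd & Ha)]; [| eauto].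
  destruct (integer_or_apart y) as [[b Eb] | (d & Hd & Hb)]; [| eauto].
  destruct Hp; exists a, b; now rewrite Ea, Eb. }
destruct H as (d & Hd & Hxy).
exists (Rmin 1 d); split; [apply Rmin_glb_lt; lra |].
intros g Hg; destruct (Gamma333_motion g Hg) as (u & k & b & [-> | Hu] & Eg).
- destruct (hex_pt_norm k b) as [E | Hn].
  + left; intros z; rewrite Eg, E; ring.
  + right; rewrite Eg.
    replace (1 * oblique x y + hex_pt k b - oblique x y)%C with (hex_pt k b) by ring.
    eapply Rle_trans; [apply Rmin_l | exact Hn].
- right; rewrite Eg; eapply Rle_trans; [apply Rmin_r |].
  destruct (rotation_displacement u k b x y Hu) as [[a Ha] [a' Ha']].
  destruct Hxy as [H | H]; eauto using Rle_trans.
Qed.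

(** Moving a pair [g z], [h w] by the inverse of [h] keeps its distance and returns the second point
    to [w], so only the images of [z] compete in the infimum. *)
Lemma flat_dist_proj z w :
  (forall g, Gamma333 g -> Cmod (z - w) <= Cmod (g z - w)) ->
  flat_dist (proj z) (proj w) = Cmod (z - w).
Proof.
intros H; unfold flat_dist.
rewrite (is_glb_Rbar_unique _ (Finite (Cmod (z - w)))); [reflexivity |].
split.
- intros r (z' & w' & (g & Hg & ->) & (h & Hh & ->) & ->); simpl.
  destruct (Gamma333_inverse h Hh) as (f & Hf & Hfh).
  rewrite <- (Gamma333_dist f (g z) (h w) Hf), Hfh.
  apply (H (fun x => f (g x))); now apply generated_comp.
- intros l Hl; apply Hl; exists z, w.
  split; [apply orbit_refl | split; [apply orbit_refl | reflexivity]].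
Qed.

Lemma proj_locally_isometric p :
  ~ Lambda p -> exists eps, 0 < eps /\
    forall z w, Cmod (z - p) < eps -> Cmod (w - p) < eps ->
      flat_dist (proj z) (proj w) = Cmod (z - w).
Proof.
intros Hp; destruct (Gamma333_displacement p Hp) as (d & Hd & Hg).
(* With radius [d / 4], [z] and [w] are less than [d / 2] apart, while for [g] not the identity
   [g z] and [w] are more than [d - d / 4 - d / 4] apart. *)
exists (d / 4); split; [lra |].
intros z w Hz Hw; apply flat_dist_proj; intros g HG.
destruct (Hg g HG) as [E | E]; [rewrite E; lra |].
assert (Hzw : Cmod (z - w) <= Cmod (z - p) + Cmod (w - p)).
{ replace (z - w)%C with ((z - p) + - (w - p))%C by ring.
  eapply Rle_trans; [apply Cmod_triangle | rewrite Cmod_opp; lra]. }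
assert (Hgp : Cmod (g p - p) <= Cmod (g z - g p) + Cmod (g z - w) + Cmod (w - p)).
{ replace (g p - p)%C with (- (g z - g p) + ((g z - w) + (w - p)))%C by ring.
  eapply Rle_trans; [apply Cmod_triangle |]; rewrite Cmod_opp.
  pose proof (Cmod_triangle (g z - w) (w - p)); lra. }
rewrite (Gamma333_dist g z p HG) in Hgp; lra.
Qed.

(** * Smoothness of affine maps, periodic extension, and iterates *)

(** By induction every iterated derivative is again affine. *)
Lemma ex_derive_n_affine a b k x : ex_derive_n (fun u => a + u * b) k x.
Proof.
assert (H : forall k, exists a' b', forall x,
  Derive_n (fun u => a + u * b) k x = a' + x * b').
{ clear k x; induction k as [| k (a' & b' & IH)].
  - now exists a, b.
  - exists b', 0; intros x; simpl; rewrite (Derive_ext _ _ x IH).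
    apply is_derive_unique; auto_derive; [exact I | ring]. }
destruct k as [| k]; [exact I |].
destruct (H k) as (a' & b' & E); simpl.
apply (ex_derive_ext (fun u => a' + u * b')); [intros t; now rewrite E |].
auto_derive; exact I.
Qed.

Lemma periodic_Z (A : Type) (f : R -> A) T :
  (forall t, f (t + T) = f t) -> forall (k : Z) t, f (t + IZR k * T) = f t.
Proof.
intros H.
assert (Hn : forall (n : nat) t, f (t + INR n * T) = f t).
{ induction n as [| n IH]; intros t.
  - f_equal; simpl; ring.
  - rewrite S_INR, <- (IH t), <- (H (t + INR n * T)); f_equal; ring. }
intros k t; destruct (Z_le_gt_dec 0 k) as [Hk | Hk].
- now rewrite <- (Z2Nat.id k Hk), <- INR_IZR_INZ.
- rewrite <- (Hn (Z.to_nat (- k))), INR_IZR_INZ, Z2Nat.id, opp_IZR by lia.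
  f_equal; ring.
Qed.

(** [T * frac_part (t / T)] differs from [t] by an integer multiple of [T]. *)
Lemma periodize_periodic c T :
  0 < T -> (forall t, c (t + T) = c t) -> periodize c T = c.
Proof.
intros HT H; apply functional_extensionality; intros t.
unfold periodize, frac_part.
rewrite <- (periodic_Z _ c T H (Int_part (t / T))).
f_equal; field; lra.
Qed.

Lemma frac_part_add1 x : frac_part (x + 1) = frac_part x.
Proof.
unfold frac_part.
assert (E : Int_part (x + 1) = (Int_part x + 1)%Z).
{ symmetry; apply Int_part_spec; rewrite plus_IZR.
  destruct (base_Int_part x); lra. }
rewrite E, plus_IZR; ring.
Qed.

Lemma periodize_add c T t : 0 < T -> periodize c T (t + T) = periodize c T t.
Proof.
intros HT; unfold periodize.
replace ((t + T) / T) with (t / T + 1) by (field; lra).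
now rewrite frac_part_add1.
Qed.

(** A shift by [T / k] advances the parameter of [d] by exactly one period [S]. The bounds on [t]
    keep both parameters in [[0, T]], where [iterate_of] speaks about [c]. *)
Lemma iterate_of_shift k d S c T t :
  (0 < k)%nat -> 0 < S -> 0 < T -> iterate_of k d S c T ->
  0 <= t -> t + T / INR k <= T -> c (t + T / INR k) = c t.
Proof.
intros Hk HS HT Hi H0 H1.
assert (Hk' : 0 < INR k) by now apply lt_0_INR.
assert (0 < T / INR k) by now apply Rdiv_lt_0_compat.
rewrite (Hi (t + T / INR k)), (Hi t), <- (periodize_add d S (INR k * S / T * t) HS) by lra.
f_equal; field; lra.
Qed.

(** * Projections of straight lines that avoid [Lambda] *)

Section Line.

Variables (p v : C).

Let ell (t : R) : C := (p + RtoC t * v)%C.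

Hypothesis ell_off_Lambda : forall t, ~ Lambda (ell t).
Hypothesis v_neq0 : v <> RtoC 0.

Lemma smooth_curve_line : smooth_curve (fun t => proj (ell t)).
Proof.
intros t; exists 1, ell; split; [lra |].
intros s _; split; [reflexivity |]; intros k; split.
- apply (ex_derive_n_ext (fun u => fst p + u * fst v)).
  + intros u; simpl; ring.
  + apply ex_derive_n_affine.
- apply (ex_derive_n_ext (fun u => snd p + u * snd v)).
  + intros u; simpl; ring.
  + apply ex_derive_n_affine.
Qed.

Lemma line_dist s t : Cmod (ell s - ell t) = Cmod v * Rabs (s - t).
Proof.
replace (ell s - ell t)%C with (RtoC (s - t) * v)%C
  by (unfold ell; rewrite RtoC_minus; ring).
rewrite Cmod_mult, Cmod_R; ring.
Qed.

Lemma locally_geodesic_line : locally_geodesic (fun t => proj (ell t)) (Cmod v).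
Proof.
assert (Hv : 0 < Cmod v) by now apply Cmod_gt_0.
intros t; destruct (proj_locally_isometric (ell t) (ell_off_Lambda t))
  as (eps & Heps & H).
exists (eps / Cmod v); split; [now apply Rdiv_lt_0_compat |].
assert (Hlt : forall s, Rabs (s - t) < eps / Cmod v -> Cmod (ell s - ell t) < eps).
{ intros s Hs; rewrite line_dist, Rmult_comm.
  now apply Rlt_div_r. }
intros s s' Hs Hs'; rewrite H by auto; apply line_dist.
Qed.

(** The projected line is [T]-periodic on all of [R], so it is its own periodic extension and the
    closing point needs no separate treatment. *)
Lemma closed_geodesic_line T :
  0 < T -> Hex (RtoC T * v) -> closed_geodesic (fun t => proj (ell t)) T.
Proof.
intros HT HH.
assert (Hper : forall t, proj (ell (t + T)) = proj (ell t)).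
{ apply Hex_hex_pt in HH; destruct HH as (k & b & E); intros t.
  rewrite <- (proj_translation (ell t) k b), <- E.
  f_equal; unfold ell; rewrite RtoC_plus; ring. }
split; [exact HT |]; split; [| split].
- rewrite <- Hper; f_equal; f_equal; ring.
- intros t _ Hvx; exact (ell_off_Lambda t (vertex_Lambda _ Hvx)).
- rewrite periodize_periodic by assumption; split; [apply smooth_curve_line |].
  exists (Cmod v); split; [now apply Cmod_gt_0 | apply locally_geodesic_line].
Qed.

Lemma proj_ell_eq s t :
  proj (ell s) = proj (ell t) -> exists u k b, hex_unit u /\
    ell t = (u * ell s + hex_pt k b)%C.
Proof.
intros E; apply proj_eq in E; destruct E as (g & Hg & E).
destruct (Gamma333_motion g Hg) as (u & k & b & Hu & Eg).
exists u, k, b; split; [exact Hu | now rewrite E, Eg].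
Qed.

(* Two parameters sharing the rotational part [u <> 1] differ by a multiple
   of [(1 - u) v] in the lattice, so they cannot be too close. *)
Lemma same_unit_apart u k b k' b' s t tau :
  u = zeta \/ u = (zeta * zeta)%C -> s <> t ->
  ell (s + tau) = (u * ell s + hex_pt k b)%C ->
  ell (t + tau) = (u * ell t + hex_pt k' b')%C ->
  1 <= 2 * Cmod v * Rabs (s - t).
Proof.
intros Hu Hst Es Et.
assert (E : (RtoC (s - t) * v - u * (RtoC (s - t) * v))%C
  = hex_pt (k - k') (b - b')).
{ unfold Z.sub; rewrite <- hex_pt_add, <- hex_pt_opp.
  transitivity (ell (s + tau) - ell (t + tau) - u * (ell s - ell t))%C.
  - unfold ell; rewrite RtoC_minus, !RtoC_plus; ring.
  - rewrite Es, Et; ring. }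
set (w := (RtoC (s - t) * v)%C) in E.
assert (Hw : Cmod w = Cmod v * Rabs (s - t))
  by (unfold w; rewrite Cmod_mult, Cmod_R; ring).
destruct (hex_pt_norm (k - k') (b - b')) as [E0 | Hn].
(* If the lattice vector vanishes, [w] is fixed by a nontrivial rotation about [0], hence is [0],
   against [s <> t] and [v <> 0]. *)
- exfalso; rewrite E0 in E.
  assert (Hw0 : w = RtoC 0).
  { destruct (oblique_surj w) as (x & y & Ew); rewrite Ew in E |- *.
    unfold Cminus in E; rewrite RtoC_oblique in E |- *.
    destruct Hu as [-> | ->]; [| rewrite <- Cmult_assoc in E];
      rewrite !zeta_oblique, oblique_opp, oblique_add in E;
      apply oblique_inj in E; destruct E; f_equal; lra. }
  revert Hw0; apply Cmult_neq_0; [| exact v_neq0].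
  intros H; apply RtoC_inj in H; lra.
- rewrite <- E in Hn.
  assert (Cmod (w - u * w) <= Cmod w + Cmod w).
  { unfold Cminus; eapply Rle_trans; [apply Cmod_triangle |].
    rewrite Cmod_opp, Cmod_mult, (Cmod_hex_unit u); [lra |].
    now right. }
  lra.
Qed.

(** The motions at the parameters [0], [e], [2 e] are compared. If one is a translation, it is the
    translation by [tau v]; otherwise two of them share one of the two nontrivial units, although
    their parameters are too close for that. *)
Lemma line_shift_Hex tau r :
  0 < r ->
  (forall t, 0 <= t <= r -> proj (ell (t + tau)) = proj (ell t)) ->
  Hex (RtoC tau * v).
Proof.
intros Hr H; apply Hex_hex_pt.
assert (Hv : 0 < Cmod v) by now apply Cmod_gt_0.
(* The first bound keeps [2 e] within [[0, r]]; the second gives [2 * Cmod v * (2 * e) <= 1 / 2],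
   contradicting [same_unit_apart]. *)
set (e := Rmin (r / 2) (/ (8 * Cmod v))).
assert (He : 0 < e).
{ apply Rmin_glb_lt; [lra | apply Rinv_0_lt_compat; lra]. }
assert (Her : 2 * e <= r).
{ pose proof (Rmin_l (r / 2) (/ (8 * Cmod v))); unfold e; lra. }
assert (Hev : 2 * Cmod v * (2 * e) < 1).
{ assert (e <= / (8 * Cmod v)) by apply Rmin_r.
  apply (Rmult_le_compat_l (8 * Cmod v)) in H0; [| lra].
  rewrite Rinv_r in H0 by lra; lra. }
assert (Hm : forall t, 0 <= t <= r -> exists u k b, hex_unit u /\
  ell (t + tau) = (u * ell t + hex_pt k b)%C).
{ intros t Ht; apply proj_ell_eq; symmetry; now apply H. }
assert (Hone : forall t k b, ell (t + tau) = (RtoC 1 * ell t + hex_pt k b)%C ->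
  exists k b, (RtoC tau * v)%C = hex_pt k b).
{ intros t k b E; exists k, b.
  transitivity (ell (t + tau) - ell t)%C.
  - unfold ell; rewrite RtoC_plus; ring.
  - rewrite E; ring. }
destruct (Hm 0) as (u0 & k0 & b0 & [-> | Hu0] & E0); [lra | eauto |].
destruct (Hm e) as (u1 & k1 & b1 & [-> | Hu1] & E1); [lra | eauto |].
destruct (Hm (2 * e)) as (u2 & k2 & b2 & [-> | Hu2] & E2); [lra | eauto |].
exfalso.
assert (Hclose : forall s t u k b k' b', u = zeta \/ u = (zeta * zeta)%C ->
  0 <= s -> s < t -> t <= 2 * e ->
  ell (s + tau) = (u * ell s + hex_pt k b)%C ->
  ell (t + tau) = (u * ell t + hex_pt k' b')%C -> False).
{ intros s t u k b k' b' Hu Hs Hst Ht Es Et.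
  assert (1 <= 2 * Cmod v * Rabs (s - t))
    by (eapply same_unit_apart; eauto; lra).
  assert (Rabs (s - t) <= 2 * e) by (apply Rabs_le; lra).
  assert (2 * Cmod v * Rabs (s - t) <= 2 * Cmod v * (2 * e))
    by (apply Rmult_le_compat_l; lra).
  lra. }
assert (Hpigeon : u0 = u1 \/ u0 = u2 \/ u1 = u2).
{ destruct Hu0 as [-> | ->], Hu1 as [-> | ->], Hu2 as [-> | ->]; auto. }
destruct Hpigeon as [<- | [<- | <-]].
- apply (Hclose 0 e u0 k0 b0 k1 b1); auto; lra.
- apply (Hclose 0 (2 * e) u0 k0 b0 k2 b2); auto; lra.
- apply (Hclose e (2 * e) u1 k1 b1 k2 b2); auto; lra.
Qed.

Lemma primitive_closed_geodesic_line T :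
  0 < T -> Hex (RtoC T * v) ->
  (forall k : nat, (2 <= k)%nat -> ~ Hex (RtoC (T / INR k) * v)) ->
  primitive_closed_geodesic (fun t => proj (ell t)) T.
Proof.
intros HT HH Hk; split; [now apply closed_geodesic_line |].
intros (k & d & S & Hk2 & [HS _] & Hi); apply (Hk k Hk2).
assert (Hk' : 2 <= INR k) by (apply (le_INR 2), Hk2).
assert (Hr : T / INR k < T).
{ apply Rlt_div_l; [lra | nra]. }
(* The shifted parameter stays in [[0, T]] for [t] up to [T - T / k], which is positive because
   [k >= 2]. *)
apply (line_shift_Hex (T / INR k) (T - T / INR k)); [lra |].
intros t Ht; apply (iterate_of_shift k d S (fun t => proj (ell t)) T t);
  auto; try lra; lia.
Qed.

End Line.

(** * Arithmetic of [m] and [n], and the two cases *)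

(** Clearing denominators in the coordinates turns membership in [Hex] into divisibility of [T m]
    and [T n] by [k]. *)
Lemma Hex_oblique_scal m n T k :
  (0 < k)%nat ->
  Hex (RtoC (IZR T / INR k) * oblique (IZR m) (IZR n)) ->
  exists p q, (T * m = Z.of_nat k * (q + 3 * p))%Z /\ (T * n = Z.of_nat k * q)%Z.
Proof.
intros Hk H; apply Hex_hex_pt in H; destruct H as (p & q & E); exists p, q.
assert (Hk' : 0 < INR k) by now apply lt_0_INR.
unfold hex_pt in E; rewrite oblique_scal in E; apply oblique_inj in E.
destruct E as [E1 E2].
split; apply eq_IZR; rewrite !mult_IZR, <- INR_IZR_INZ.
- rewrite plus_IZR, mult_IZR, <- E1; field; lra.
- rewrite <- E2; field; lra.
Qed.

(** A Bezout relation [u m + v n = 1] gives [T = u (T m) + v (T n)]. *)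
Lemma rel_prime_scal_divide m n T k :
  rel_prime m n -> (k | T * m)%Z -> (k | T * n)%Z -> (k | T)%Z.
Proof.
intros Hmn Hm Hn.
destruct (rel_prime_bezout m n Hmn) as [u v E].
replace T with (u * (T * m) + v * (T * n))%Z
  by (transitivity (T * (u * m + v * n))%Z; [ring | rewrite E; ring]).
apply Z.divide_add_r; now apply Z.divide_mul_r.
Qed.

(** Eliminating [t] from [1 / 2 + t m = a] and [t n = b] gives [n + 2 b m = 2 a n], which would make
    [n] even. *)
Lemma half_line_off_Lambda m n t :
  Z.Odd n -> ~ Lambda (RtoC (1 / 2) + RtoC t * oblique (IZR m) (IZR n)).
Proof.
intros [c Hc]; rewrite RtoC_oblique, oblique_scal, oblique_add; intros H.
apply Lambda_oblique in H; destruct H as (a & b & Ea & Eb).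
assert (E : IZR (n + 2 * b * m) = IZR (2 * a * n)).
{ rewrite plus_IZR, !mult_IZR, <- Ea, <- Eb; field. }
apply eq_IZR in E; lia.
Qed.

Theorem theorem4 (m n : Z) (hmn : rel_prime m n) (hn : Z.Odd n) :
  let omega0 : C := (RtoC (IZR m) + RtoC (IZR n) * omega)%C in
  let ell : R -> C := fun t => (RtoC (1 / 2) + RtoC t * omega0)%C in
  let gamma : R -> double_triangle := fun t => proj (ell t) in
  (Hex omega0 -> primitive_closed_geodesic gamma 1) /\
  (~ Hex omega0 -> primitive_closed_geodesic gamma 3).
Proof.
intros omega0 ell gamma.
assert (Hell : forall t, ~ Lambda (ell t)) by (intros t; now apply half_line_off_Lambda).
assert (H0 : omega0 <> RtoC 0).
{ change omega0 with (oblique (IZR m) (IZR n)); rewrite RtoC_oblique; intros E.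
  apply oblique_inj in E; destruct E as [_ E]; apply eq_IZR in E.
  destruct hn; lia. }
split; intros HH; apply primitive_closed_geodesic_line; auto; try lra.
- now rewrite Cmult_1_l.
- intros k Hk Hex1.
  apply (Hex_oblique_scal m n 1 k) in Hex1; [| lia].
  destruct Hex1 as (p & q & E1 & E2).
  assert (Hd : (Z.of_nat k | 1)%Z)
    by (apply (rel_prime_scal_divide m n); [exact hmn | rewrite E1 | rewrite E2];
        apply Z.divide_factor_l).
  apply Z.divide_pos_le in Hd; lia.
(* [3 omega0] is always in [Hex], as [3 m = 3 n + 3 (m - n)]. *)
- apply Hex_hex_pt; exists (m - n)%Z, (3 * n)%Z; unfold hex_pt.
  change omega0 with (oblique (IZR m) (IZR n)).
  rewrite oblique_scal, mult_IZR, minus_IZR; f_equal; ring.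
- intros k Hk Hex3; apply HH.
  apply (Hex_oblique_scal m n 3 k) in Hex3; [| lia].
  destruct Hex3 as (p & q & E1 & E2).
  assert (Hd : (Z.of_nat k | 3)%Z)
    by (apply (rel_prime_scal_divide m n); [exact hmn | rewrite E1 | rewrite E2];
        apply Z.divide_factor_l).
  assert (Hk3 : Z.of_nat k = 3%Z).
  { pose proof (Z.divide_pos_le _ 3 eq_refl Hd).
    destruct (Z.eq_dec (Z.of_nat k) 2) as [E | NE]; [| lia].
    rewrite E in Hd; destruct Hd; lia. }
  (* For [k = 3] the factor 3 cancels, leaving [m = q + 3 p] and [n = q], that is, [omega0] in
     [Hex]. *)
  rewrite Hk3 in E1, E2.
  apply Hex_hex_pt; exists p, q.
  change omega0 with (oblique (IZR m) (IZR n)); unfold hex_pt.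
  f_equal; [rewrite <- mult_IZR, <- plus_IZR |]; f_equal; lia.
Qed.
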